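(* Let $\Phi$ be a Legendre function on $\mathbb{R}^d$, $E:=\operatorname{int}\operatorname{dom}\Phi$, let $f:E\to\mathbb{R}$ be differentiable and let $\Omega:E\to\mathbb{R}^d$ be a vector field. Let $t\ge 2$, let $\mathcal K\subset E$, let $\mathbf{x}_*$ be a minimizer of $f$ over $\mathcal K$, and let $U\subset\mathcal K$ be a set containing $\mathbf{x}_*$. Assume that $$\langle\Omega(\mathbf{x}),\mathbf{x}-\mathbf{x}_*\rangle\ge f(\mathbf{x})-f(\mathbf{x}_* )\qquad\text{for all }\mathbf{x}\in\mathcal K\setminus U.$$ Let $\eta_1,\dots,\eta_{t-1}>0$ and let $\mathbf{x}_1,\dots,\mathbf{x}_t\in\mathcal K$ satisfy $\nabla\Phi(\mathbf{x}_j)-\eta_j\Omega(\mathbf{x}_j)\in\operatorname{int}\operatorname{dom}\Phi^*$ and $\mathbf{x}_{j+1}=\nabla\Phi^*\bigl(\nabla\Phi(\mathbf{x}_j)-\eta_j\Omega(\mathbf{x}_j)\bigr)$ for $j=1,\dots,t-1$. Assume that $$\eta_j D_{f,\Omega}(\mathbf{x}_{j+1}\|\mathbf{x}_j)\le D_\Phi(\mathbf{x}_{j+1}\|\mathbf{x}_j),\qquad j=1,\dots,t-1.$$ Then $$f(\mathbf{x}_t)-f(\mathbf{x}_* )\le\max\left\{\frac{D_\Phi(\mathbf{x}_*\|\mathbf{x}_1)}{\sum_{j=1}^{t-1}\eta_j},\ \sup_{\mathbf{x}\in U}\bigl(f(\mathbf{x})-f(\mathbf{x}_* )\bigr)\right\},$$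 where the supremum may be $+\infty$.
   Context: A Legendre function $\Phi:\mathbb{R}^d\to\mathbb{R}\cup\{+\infty\}$ is a closed proper convex function that is essentially smooth and essentially strictly convex; then $\nabla\Phi$ is a bijection from $\operatorname{int}\operatorname{dom}\Phi$ onto $\operatorname{int}\operatorname{dom}\Phi^*$ with inverse $\nabla\Phi^*$, where $\Phi^*$ is the convex conjugate. The Bregman divergence is $D_\Phi(\mathbf{x}\|\mathbf{y})=\Phi(\mathbf{x})-\Phi(\mathbf{y})-\langle\nabla\Phi(\mathbf{y}),\mathbf{x}-\mathbf{y}\rangle$. For a function $f$ and a vector field $\Omega$, $D_{f,\Omega}(\mathbf{x}\|\mathbf{y}):=\langle\Omega(\mathbf{y}),\mathbf{y}-\mathbf{x}\rangle-f(\mathbf{y})+f(\mathbf{x})$. *)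

(* Defs.v *)
From mathcomp Require Import all_boot all_order all_algebra.
From mathcomp Require Import all_classical all_reals all_analysis.

Set Implicit Arguments.
Unset Strict Implicit.
Unset Printing Implicit Defensive.

Import Order.TTheory GRing.Theory Num.Theory numFieldNormedType.Exports.

Local Open Scope classical_set_scope.
Local Open Scope ring_scope.

Definition dotp (R : realType) (d : nat) (u v : 'rV[R]_d) : R :=
  \sum_(i < d) u 0 i * v 0 i.

Definition edom (R : realType) (d : nat) (Phi : 'rV[R]_d -> \bar R) :
    set 'rV[R]_d :=
  [set x | (Phi x < +oo)%E].

Definition proper_fun (R : realType) (d : nat) (Phi : 'rV[R]_d -> \bar R) :
    Prop :=
  (forall x, (-oo < Phi x)%E) /\ edom Phi !=set0.

Definition econvex (R : realType) (d : nat) (Phi : 'rV[R]_d -> \bar R) : Prop :=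
  forall (x y : 'rV[R]_d) (s : R), 0 < s < 1 ->
    (Phi (s *: x + (1 - s) *: y)%R <= s%:E * Phi x + (1 - s)%:E * Phi y)%E.

Definition strictly_convex_on (R : realType) (d : nat) (C : set 'rV[R]_d)
    (Phi : 'rV[R]_d -> \bar R) : Prop :=
  forall (x y : 'rV[R]_d) (s : R), C x -> C y -> x != y -> 0 < s < 1 ->
    (Phi (s *: x + (1 - s) *: y)%R < s%:E * Phi x + (1 - s)%:E * Phi y)%E.

(* The vector of partial derivatives; [fine] turns the extended-real valued
   [Phi] into a real-valued function, so this is meaningful only at interior
   points of the domain of a proper [Phi] where [Phi] is differentiable. *)
Definition grad (R : realType) (d : nat) (Phi : 'rV[R]_d -> \bar R)
    (x : 'rV[R]_d) : 'rV[R]_d :=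
  \row_(i < d) 'D_(delta_mx 0 i : 'rV[R]_d) (fun y => fine (Phi y)) x.

Definition subdiff (R : realType) (d : nat) (Phi : 'rV[R]_d -> \bar R)
    (x : 'rV[R]_d) : set 'rV[R]_d :=
  [set g | forall y, (Phi x + (dotp g (y - x)%R)%:E <= Phi y)%E].

(* Rockafellar, Convex Analysis, section 26.  The norm is the library's (the
   maximum norm); all norms on R^d have the same sequences tending to
   infinity. *)
Definition essentially_smooth (R : realType) (d : nat)
    (Phi : 'rV[R]_d -> \bar R) : Prop :=
  let E := interior (edom Phi) in
  [/\ E !=set0,
      forall x, E x -> differentiable (fun y => fine (Phi y)) x &
      forall (u : nat -> 'rV[R]_d) (z : 'rV[R]_d),
        (forall n, E (u n)) -> (closure E `\` E) z -> u n @[n --> \oo] --> z ->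
        `|grad Phi (u n)| @[n --> \oo] --> +oo].

Definition essentially_strictly_convex (R : realType) (d : nat)
    (Phi : 'rV[R]_d -> \bar R) : Prop :=
  forall C : set 'rV[R]_d, convex_set C ->
    C `<=` [set x | subdiff Phi x !=set0] -> strictly_convex_on C Phi.

(* For a proper convex function, closed means lower semicontinuous. *)
Definition Legendre (R : realType) (d : nat) (Phi : 'rV[R]_d -> \bar R) :
    Prop :=
  [/\ proper_fun Phi, econvex Phi, lower_semicontinuous Phi,
      essentially_smooth Phi & essentially_strictly_convex Phi].

Definition conjugate (R : realType) (d : nat) (Phi : 'rV[R]_d -> \bar R)
    (y : 'rV[R]_d) : \bar R :=
  ereal_sup [set ((dotp y x)%:E - Phi x)%E | x in setT].

Definition bregman (R : realType) (d : nat) (Phi : 'rV[R]_d -> \bar R)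
    (x y : 'rV[R]_d) : \bar R :=
  (Phi x - Phi y - (dotp (grad Phi y) (x - y)%R)%:E)%E.

Definition fdiv (R : realType) (d : nat) (f : 'rV[R]_d -> R)
    (Omega : 'rV[R]_d -> 'rV[R]_d) (x y : 'rV[R]_d) : R :=
  dotp (Omega y) (y - x) - f y + f x.

Definition minimizer_over (R : realType) (d : nat) (f : 'rV[R]_d -> R)
    (K : set 'rV[R]_d) (xs : 'rV[R]_d) : Prop :=
  K xs /\ forall x, K x -> f xs <= f x.

(* Main.v *)
(* Since [y = grad Phi (x j) - eta j *: Omega (x j)] lies in the interior of
   [dom Phi^*], [Phi - <y, .>] is coercive; it attains its minimum at a point
   [z], which is unique by essential strict convexity.  Uniqueness forces
   [grad Phi^* y = z], so [x j.+1 = z] is interior to [dom Phi] and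
   [grad Phi (x j.+1) = y] is a subgradient there.
   The three-point identity then turns the step condition into
     eta j (f (x j.+1) - f (x j)) + eta j <Omega (x j), x j - p>
       <= D p (x j) - D p (x j.+1).
   With [p = x j] it shows that [f (x j)] is nonincreasing, so either some
   [x j] is in [U] and [f (x t)] is below the supremum over [U], or the growth
   hypothesis on [Omega] holds along the whole trajectory and the case [p = xs]
   telescopes. *)

Require Import Defs.
From mathcomp Require Import all_boot all_order all_algebra.
From mathcomp Require Import all_classical all_reals all_analysis.
From mathcomp Require Import ring lra.

Set Implicit Arguments.
Unset Strict Implicit.
Unset Printing Implicit Defensive.

Import Order.TTheory GRing.Theory Num.Theory numFieldNormedType.Exports.

Local Open Scope classical_set_scope.
Local Open Scope ring_scope.

(** * Minima of extended-real lower semicontinuous functions on compact sets *)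

Lemma lte_dense_fin (R : realType) (u v : \bar R) :
  (u < v)%E -> exists2 b : R, (u < b%:E)%E & (b%:E < v)%E.
Proof.
case: u v => [r||] [s||] //; rewrite ?lte_fin.
- by move=> rs; exists ((r + s) / 2); rewrite lte_fin; lra.
- by move=> _; exists (r + 1); [rewrite lte_fin; lra|exact: ltry].
- by move=> _; exists (s - 1); [exact: ltNyr|rewrite lte_fin; lra].
- by move=> _; exists 0; rewrite ?ltNyr ?ltry.
Qed.

(** The sublevel sets [B q] are nested, so they generate a proper filter, and compactness gives it a
    cluster point [p]. If [F q < F p], semicontinuity would separate a neighbourhood of [p] from
    [B q]. *)
Lemma lsc_compact_min (R : realType) (T : topologicalType) (F : T -> \bar R)
    (A : set T) :
  lower_semicontinuous F -> compact A -> A !=set0 ->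
  exists2 p, A p & forall q, A q -> (F p <= F q)%E.
Proof.
move=> lscF cA [a0 Aa0].
pose B q := [set x | A x /\ (F x <= F q)%E].
have FB : ProperFilter (filter_from A B).
  apply: (filter_from_proper (filter_from_filter _ _)) => [|i j Ai Aj|i Ai].
  - by exists a0.
  - have [ij|ji] := leP (F i) (F j).
    + by exists i => // x [Ax xi]; split; split => //; apply: le_trans ij.
    + by exists j => // x [Ax xi]; split; split => //; apply: le_trans (ltW ji).
  - by exists i.
have [|p [Ap clp]] := cA _ FB; first by exists a0 => // x [].
exists p => // q Aq; rewrite leNgt; apply/negP => /lte_dense_fin[b qb bp].
have [V pV FV] := lscF _ _ bp.
have [x [[_ xq] /FV bx]] : B q `&` V !=set0 by apply: clp => //; exists q.
by have := lt_trans bx (le_lt_trans xq qb); rewrite ltxx.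
Qed.

(** * Inner product and maximum norm on row vectors *)

Section euclid.
Context (R : realType) (d : nat).
Implicit Types (u v w : 'rV[R]_d).

Lemma dotpDl u v w : dotp (u + v) w = dotp u w + dotp v w.
Proof.
by rewrite /dotp -big_split; apply: eq_bigr => i _; rewrite mxE mulrDl.
Qed.

Lemma dotpZl (a : R) v w : dotp (a *: v) w = a * dotp v w.
Proof.
by rewrite /dotp mulr_sumr; apply: eq_bigr => i _; rewrite mxE mulrA.
Qed.

Lemma dotpC u v : dotp u v = dotp v u.
Proof. by apply: eq_bigr => i _; rewrite mulrC. Qed.

Lemma dotpDr u v w : dotp w (u + v) = dotp w u + dotp w v.
Proof. by rewrite !(dotpC w) dotpDl. Qed.

Lemma dotpZr (a : R) v w : dotp w (a *: v) = a * dotp w v.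
Proof. by rewrite !(dotpC w) dotpZl. Qed.

Lemma dotpBl u v w : dotp (u - v) w = dotp u w - dotp v w.
Proof. by rewrite -scaleN1r dotpDl dotpZl mulN1r. Qed.

Lemma dotpBr u v w : dotp w (u - v) = dotp w u - dotp w v.
Proof. by rewrite !(dotpC w) dotpBl. Qed.

Lemma dotp_delta i w : dotp (delta_mx 0 i) w = w 0 i.
Proof.
rewrite /dotp (bigD1 i)//= big1 ?addr0 ?mxE ?eqxx ?mul1r// => j ji.
by rewrite mxE (negbTE ji) andbF mul0r.
Qed.

Lemma norm_coord_le w i : `|w 0 i| <= `|w|.
Proof.
rewrite [leRHS]/Num.Def.normr/= mx_normrE; apply/bigmax_geP; right => /=.
by exists (0, i).
Qed.

Lemma row_norm_le (B : R) w :
  0 <= B -> (forall i, `|w 0 i| <= B) -> `|w| <= B.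
Proof.
move=> B0 wB; rewrite [leLHS]/Num.Def.normr/= mx_normrE.
by apply: bigmax_le => // -[i j] _ /=; rewrite ord1.
Qed.

Lemma dotp_continuous u : continuous (dotp u).
Proof.
apply: continuous_big => [|i _ w]; first exact: add_continuous.
apply: (@continuousM R _ (fun=> u 0 i) (fun x : 'rV[R]_d => x 0 i)).
  exact: cst_continuous.
exact: coord_continuous.
Qed.

(** The parameter [P] covers both uses: a ray for closed balls, a singleton for spheres. *)
Lemma compact_norm (z : 'rV[R]_d) (P : set R) (B : R) :
  closed P -> P `<=` [set r | r <= B] -> compact [set w | P `|w - z|].
Proof.
move=> clP PB; apply: bounded_closed_compact.
  exists (B + `|z|); split => [|M BM w /PB /= wB]; first exact: num_real.
  apply: le_trans (ltW BM); rewrite -[w](subrK z).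
  by apply: le_trans (ler_normD _ _) _; rewrite lerD2r.
apply: (@closed_comp _ _ (fun w => `|w - z|)) => // w _.
apply: (@continuous_comp _ _ _ (fun w => w - z) Num.norm).
  by apply: (@continuousB _ _ _ id (cst z)) => //; exact: cst_continuous.
exact: norm_continuous.
Qed.

End euclid.

(** * Conjugates, subgradients and existence of a dual point *)

Lemma lsc_sub_dotp (R : realType) (d : nat) (Phi : 'rV[R]_d -> \bar R)
    (y : 'rV[R]_d) :
  lower_semicontinuous Phi ->
  lower_semicontinuous (fun w => Phi w - (dotp y w)%:E)%E.
Proof.
move=> lsc x a; rewrite lteBrDr// -EFinD => /lte_dense_fin[b].
rewrite lte_fin => ab bx; have [V xV Vb] := lsc _ _ bx.
exists (V `&` [set w | dotp y w < b - a]).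
  apply: filterI => //.
  by apply: (cvgr_lt _ (@dotp_continuous R d y x)); lra.
move=> w [/Vb bw /= wba]; rewrite EFinN lteBrDr// -EFinD.
by apply: lt_trans bw; rewrite lte_fin; lra.
Qed.

Lemma conjugate_ge (R : realType) (d : nat) (Phi : 'rV[R]_d -> \bar R)
    (y w : 'rV[R]_d) (b : R) :
  Phi w = b%:E -> ((dotp y w - b)%:E <= conjugate Phi y)%E.
Proof. by move=> Pw; apply: ereal_sup_ubound; exists w => //; rewrite Pw. Qed.

Lemma proper_fin (R : realType) (d : nat) (Phi : 'rV[R]_d -> \bar R)
    (w : 'rV[R]_d) :
  proper_fun Phi -> edom Phi w -> exists a, Phi w = a%:E.
Proof.
rewrite /edom/= => -[/(_ w)]; case: (Phi w) => // a _ _ _.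
by exists a.
Qed.

Lemma conjugate_fin (R : realType) (d : nat) (Phi : 'rV[R]_d -> \bar R)
    (y : 'rV[R]_d) :
  proper_fun Phi -> edom (conjugate Phi) y ->
  exists a, conjugate Phi y = a%:E.
Proof.
move=> pPhi; have [_ [w0 /(proper_fin pPhi)[b Pw0]]] := pPhi.
have := @conjugate_ge _ _ _ y _ _ Pw0.
by rewrite /edom/=; case: (conjugate Phi y) => // a _ _; exists a.
Qed.

Lemma subdiff_fin (R : realType) (d : nat) (Phi : 'rV[R]_d -> \bar R)
    (z y : 'rV[R]_d) :
  proper_fun Phi -> subdiff Phi z y -> exists a, Phi z = a%:E.
Proof.
move=> pPhi zy; have [_ [w0 /(proper_fin pPhi)[b Pw0]]] := pPhi.
have := zy w0; rewrite Pw0; have := pPhi.1 z.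
by case: (Phi z) => // a _ _; exists a.
Qed.

(** Reduces subgradients to real arithmetic: the inequality is void where [Phi] is [+oo], and
    properness excludes [-oo]. *)
Lemma subdiffP (R : realType) (d : nat) (Phi : 'rV[R]_d -> \bar R)
    (z y : 'rV[R]_d) (a : R) :
  proper_fun Phi -> Phi z = a%:E ->
  subdiff Phi z y <-> forall w b, Phi w = b%:E -> a + dotp y (w - z) <= b.
Proof.
move=> pPhi Pz; split=> [zy w b Pw|zy w].
  by have := zy w; rewrite Pz Pw -EFinD lee_fin.
rewrite Pz -EFinD; have := pPhi.1 w; have := zy w.
case: (Phi w) => [b|_ _|//]; last exact: leey.
by move=> /(_ b erefl); rewrite lee_fin.
Qed.

(* Moving [y] by [+- r] along each axis inside [dom Phi^*] gives finitely many
   affine minorants of [Phi], hence linear growth of [Phi - <y, .>]. *)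
Lemma conjugate_coercive (R : realType) (d : nat) (Phi : 'rV[R]_d -> \bar R)
    (y : 'rV[R]_d) :
  proper_fun Phi -> interior (edom (conjugate Phi)) y ->
  exists r M : R, 0 < r /\ forall w i b, Phi w = b%:E ->
    r * `|w 0 i| - M <= b - dotp y w.
Proof.
move=> pPhi /nbhs_ballP[e /= e0 eB].
have Hs (s : R) : `|s| <= e / 2 -> forall i,
    exists m, conjugate Phi (y + s *: delta_mx 0 i) = m%:E.
  move=> se i; apply: conjugate_fin => //; apply: eB.
  rewrite mx_norm_ball /ball_/= opprD addNKr normrN.
  apply: (@le_lt_trans _ _ (e / 2)); last by lra.
  apply: row_norm_le => [|j]; first by lra.
  rewrite !mxE normrM; case: (_ && _); rewrite ?normr1 ?normr0 ?mulr1 ?mulr0//.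
  by lra.
have pe : `|e / 2| <= e / 2 by rewrite ger0_norm; lra.
have ne : `|- (e / 2)| <= e / 2 by rewrite normrN.
have [mp Hp] := choice (Hs _ pe); have [mn Hn] := choice (Hs _ ne).
exists (e / 2), (\sum_i (`|mp i| + `|mn i|)); split=> [|w i b Pw]; first by lra.
have Mi : `|mp i| + `|mn i| <= \sum_i (`|mp i| + `|mn i|).
  by rewrite (bigD1 i)//= lerDl sumr_ge0// => j _; rewrite addr_ge0.
have := @conjugate_ge _ _ _ (y + (e / 2) *: delta_mx 0 i) _ _ Pw.
have := @conjugate_ge _ _ _ (y + (- (e / 2)) *: delta_mx 0 i) _ _ Pw.
rewrite Hp Hn !lee_fin !dotpDl !dotpZl !dotp_delta => h1 h2.
have := ler_norm (mp i); have := ler_norm (mn i).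
have := normr_ge0 (mp i); have := normr_ge0 (mn i).
by case: (ler0P (w 0 i)) => _; nra.
Qed.

(** By coercivity, a minimizer of [Phi - <y, .>] over a large enough ball is a global one, and [y]
    is a subgradient at any global minimizer. *)
Lemma subdiff_nonempty (R : realType) (d : nat) (Phi : 'rV[R]_d -> \bar R)
    (y : 'rV[R]_d) :
  proper_fun Phi -> lower_semicontinuous Phi ->
  interior (edom (conjugate Phi)) y -> exists z, subdiff Phi z y.
Proof.
move=> pPhi lsc /(conjugate_coercive pPhi)[r [M [r0 rM]]].
have [_ [w0 /(proper_fin pPhi)[b0 Pw0]]] := pPhi.
(* The first term puts [w0] in the ball. The second makes [r * B - M] at least the value at [w0], so
   no point outside does better than [w0]. *)
pose B := `|w0| + `|b0 - dotp y w0 + M| / r.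
have B0 : 0 <= B by rewrite addr_ge0// divr_ge0// ltW.
have cB : compact [set w : 'rV[R]_d | `|w - 0| <= B].
  by apply: (@compact_norm _ _ 0 [set s | s <= B] B) => //; exact: closed_le.
have w0B : `|w0 - 0| <= B by rewrite subr0 lerDl divr_ge0// ltW.
have [|z zB zmin] := lsc_compact_min (lsc_sub_dotp (y := y) lsc) cB.
  by exists w0.
have := zmin _ w0B; rewrite Pw0 => zw0.
have [a Pz] : exists a, Phi z = a%:E.
  by move: zw0 (pPhi.1 z); case: (Phi z) => // a _ _; exists a.
exists z; apply/(subdiffP _ pPhi Pz) => w b Pw.
have [wB|wB] := leP `|w - 0| B.
  by have := zmin _ wB; rewrite Pz Pw lee_fin dotpBr; lra.
have [i iB] : exists i, B < `|w 0 i|.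
  apply/not_existsP => h; move: wB; rewrite subr0 ltNge => /negP; apply.
  by apply: row_norm_le => // i; rewrite leNgt; apply/negP/h.
move: zw0; rewrite Pz lee_fin => zw0; rewrite dotpBr.
have := rM _ i _ Pw.
have : r * B < r * `|w 0 i| by rewrite ltr_pM2l.
rewrite {1}/B mulrDr mulrCA divff ?gt_eqF// mulr1.
have := ler_norm (b0 - dotp y w0 + M).
have : 0 <= r * `|w0| by rewrite mulr_ge0// ltW.
by lra.
Qed.

(** * Uniqueness of the dual point *)

Lemma econvex_fin (R : realType) (d : nat) (Phi : 'rV[R]_d -> \bar R)
    (x y : 'rV[R]_d) (a b s : R) :
  proper_fun Phi -> econvex Phi -> Phi x = a%:E -> Phi y = b%:E -> 0 < s < 1 ->
  exists2 c, Phi (s *: x + (1 - s) *: y) = c%:E & c <= s * a + (1 - s) * b.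
Proof.
move=> pPhi cPhi Px Py s01.
have := cPhi x y s s01; rewrite Px Py -!EFinM -EFinD.
have := pPhi.1 (s *: x + (1 - s) *: y).
by case: (Phi _) => // c _; rewrite lee_fin => ?; exists c.
Qed.

Lemma subdiff_conv (R : realType) (d : nat) (Phi : 'rV[R]_d -> \bar R)
    (y z z' : 'rV[R]_d) (s : R) :
  proper_fun Phi -> econvex Phi -> 0 < s < 1 ->
  subdiff Phi z y -> subdiff Phi z' y ->
  subdiff Phi (s *: z + (1 - s) *: z') y.
Proof.
move=> pPhi cPhi s01 zy zy'.
have [a Pz] := subdiff_fin pPhi zy; have [a' Pz'] := subdiff_fin pPhi zy'.
have [c Pc cle] := econvex_fin pPhi cPhi Pz Pz' s01.
apply/(subdiffP _ pPhi Pc) => w b Pw.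
have := (subdiffP _ pPhi Pz).1 zy _ _ Pw.
have := (subdiffP _ pPhi Pz').1 zy' _ _ Pw.
by rewrite !dotpBr dotpDr !dotpZr; case/andP: s01 => s0 s1; nra.
Qed.

(** The points with subgradient [y] minimize [Phi - <y, .>] and form a convex set, on which
    essential strict convexity applies. The midpoint of two distinct ones would fall below the
    minimum. *)
Lemma subdiff_inj (R : realType) (d : nat) (Phi : 'rV[R]_d -> \bar R)
    (y z z' : 'rV[R]_d) :
  proper_fun Phi -> econvex Phi -> essentially_strictly_convex Phi ->
  subdiff Phi z y -> subdiff Phi z' y -> z' = z.
Proof.
move=> pPhi cPhi scPhi zy zy'; apply/eqP; apply: contraT => nzz'.
have [a Pz] := subdiff_fin pPhi zy; have [a' Pz'] := subdiff_fin pPhi zy'.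
have h01 : 0 < (2^-1 : R) < 1 by lra.
have cvC : convex_set [set w | subdiff Phi w y].
  apply/convex_setW => u v /set_mem uy /set_mem vy k k0 k1; apply/mem_set.
  by apply: subdiff_conv => //; rewrite k0.
have subC : [set w | subdiff Phi w y] `<=` [set w | subdiff Phi w !=set0].
  by move=> w wy; exists y.
have := scPhi _ cvC subC z' z 2^-1 zy' zy nzz' h01.
have [c Pc _] := econvex_fin pPhi cPhi Pz' Pz h01.
rewrite Pc Pz Pz' -!EFinM -EFinD lte_fin => clt.
have := (subdiffP _ pPhi Pz).1 zy _ _ Pc.
have := (subdiffP _ pPhi Pz').1 zy' _ _ Pc.
by rewrite !dotpBr dotpDr !dotpZr; lra.
Qed.

(** * Growth away from the minimizer and the gradient of the conjugate *)

(** The gap attains its minimum on the compact sphere. Were that minimum not positive, the point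
    attaining it would be a second minimizer of [Phi - <y, .>]. *)
Lemma sphere_growth (R : realType) (d : nat) (Phi : 'rV[R]_d -> \bar R)
    (y z : 'rV[R]_d) (a e : R) :
  proper_fun Phi -> lower_semicontinuous Phi -> Phi z = a%:E ->
  subdiff Phi z y -> (forall z', subdiff Phi z' y -> z' = z) -> 0 < e ->
  exists2 k, 0 < k & forall w b, Phi w = b%:E -> `|w - z| = e ->
    k <= b - a - dotp y (w - z).
Proof.
move=> pPhi lsc Pz zy uz e0.
have cS : compact [set w : 'rV[R]_d | `|w - z| = e].
  apply: (@compact_norm _ _ z [set s | s = e] e) => [|s /= ->//].
  exact: closed_eq.
have [S0|S0] := pselect ([set w : 'rV[R]_d | `|w - z| = e] !=set0); last first.
  (* An empty sphere, as in dimension zero: any constant works. *)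
  by exists 1 => // w b _ we; exfalso; apply: S0; exists w.
have [p pe pmin] := lsc_compact_min (lsc_sub_dotp (y := y) lsc) cS S0.
have [pfin|pinf] := pselect (edom Phi p); last first.
  (* If the minimum is [+oo], [Phi] has no finite value on the sphere and the claim is vacuous. *)
  exists 1 => // w b Pw /pmin; rewrite Pw => h; exfalso; apply: pinf.
  by move: h; rewrite /edom/=; case: (Phi p) => // c; rewrite ltry.
have [c Pp] := proper_fin pPhi pfin.
exists (c - a - dotp y (p - z)) => [|w b Pw /pmin]; last first.
  by rewrite Pp Pw -!EFinB lee_fin !dotpBr; lra.
rewrite ltNge; apply/negP => cle.
have pz : p = z.
  apply: uz; apply/(subdiffP _ pPhi Pp) => w b Pw.
  have := (subdiffP _ pPhi Pz).1 zy _ _ Pw.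
  by move: cle; rewrite !dotpBr; lra.
by move: pe; rewrite /= pz subrr normr0 => ee; rewrite -ee ltxx in e0.
Qed.

(** The segment from [z] to [w] crosses the sphere at parameter [e / rho]. By convexity the gap
    there is at most [e / rho] times the gap at [w], whence the slope [k / e]. *)
Lemma linear_growth (R : realType) (d : nat) (Phi : 'rV[R]_d -> \bar R)
    (y z : 'rV[R]_d) (a e : R) :
  proper_fun Phi -> econvex Phi -> lower_semicontinuous Phi -> Phi z = a%:E ->
  subdiff Phi z y -> (forall z', subdiff Phi z' y -> z' = z) -> 0 < e ->
  exists2 k, 0 < k & forall w b, Phi w = b%:E -> e <= `|w - z| ->
    k * `|w - z| <= b - a - dotp y (w - z).
Proof.
move=> pPhi cPhi lsc Pz zy uz e0.
have [k k0 kS] := sphere_growth pPhi lsc Pz zy uz e0.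
exists (k / e) => [|w b Pw]; first by rewrite divr_gt0.
rewrite le_eqVlt => /predU1P[ew|ew].
  by rewrite -ew divfK ?gt_eqF// kS.
set rho := `|w - z| in ew *.
have rho0 : 0 < rho by apply: lt_trans ew.
have s01 : 0 < e / rho < 1 by rewrite divr_gt0//= ltr_pdivrMr// mul1r.
have [c Pc cle] := econvex_fin pPhi cPhi Pw Pz s01.
have uE : e / rho *: w + (1 - e / rho) *: z - z = (e / rho) *: (w - z).
  by rewrite scalerBl scale1r scalerBr addrA addrAC addrK.
have s0 : 0 <= e / rho by rewrite ltW//; case/andP: s01.
have := kS _ _ Pc; rewrite uE normrZ (ger0_norm s0).
rewrite -/rho divfK ?gt_eqF// => /(_ erefl); rewrite dotpZr => kc.
have -> : k / e * rho = (e / rho)^-1 * k by field; rewrite !gt_eqF.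
by rewrite ler_pdivrMl; [lra|case/andP: s01].
Qed.

(* Outside the ball of radius [e] around [z] the growth of [Phi - <y, .>] beats
   the perturbation [h * w 0 i]; inside it the perturbation varies by at most
   [`|h| * e]. *)
Lemma conjugate_expansion (R : realType) (d : nat) (Phi : 'rV[R]_d -> \bar R)
    (y z : 'rV[R]_d) (a e : R) (i : 'I_d) :
  proper_fun Phi -> econvex Phi -> lower_semicontinuous Phi -> Phi z = a%:E ->
  subdiff Phi z y -> (forall z', subdiff Phi z' y -> z' = z) -> 0 < e ->
  exists2 k, 0 < k & forall h, `|h| <= k ->
    exists2 c, conjugate Phi (h *: delta_mx 0 i + y) = c%:E &
      0 <= c - (dotp y z - a) - h * z 0 i <= `|h| * e.
Proof.
move=> pPhi cPhi lsc Pz zy uz e0.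
have [k k0 kg] := linear_growth pPhi cPhi lsc Pz zy uz e0.
exists k => // h hk; set y' := _ + y.
have y'E w : dotp y' w = h * w 0 i + dotp y w.
  by rewrite /y' dotpDl dotpZl dotp_delta.
(* The lower bound tests the supremum at [z] alone. *)
have lb := conjugate_ge y' Pz.
have ub : (conjugate Phi y' <= (dotp y z - a + h * z 0 i + `|h| * e)%:E)%E.
  apply: ub_ereal_sup => _ [w _ <-].
  have := pPhi.1 w; case Pw: (Phi w) => [b||//] _; last by rewrite leNye.
  rewrite lee_fin y'E.
  have zw := (subdiffP _ pPhi Pz).1 zy _ _ Pw.
  have hw : h * (w 0 i - z 0 i) <= `|h| * `|w - z|.
    apply: le_trans (ler_norm _) _; rewrite normrM ler_wpM2l//.
    by have := norm_coord_le (w - z) i; rewrite !mxE.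
  have [we|we] := leP e `|w - z|.
    have := kg _ _ Pw we; rewrite dotpBr.
    have : `|h| * `|w - z| <= k * `|w - z| by rewrite ler_wpM2r.
    have : 0 <= `|h| * e by rewrite mulr_ge0// ltW.
    by lra.
  have : `|h| * `|w - z| <= `|h| * e by rewrite ler_wpM2l// ltW.
  by move: zw; rewrite dotpBr; lra.
move: lb ub; case: (conjugate Phi y') => // c; rewrite !lee_fin y'E => lb ub.
by exists c => //; apply/andP; split; lra.
Qed.

(** The expansion keeps each partial difference quotient within [e] of the coordinate of [z], for
    arbitrary [e]. *)
Lemma grad_conjugate (R : realType) (d : nat) (Phi : 'rV[R]_d -> \bar R)
    (y z : 'rV[R]_d) :
  proper_fun Phi -> econvex Phi -> lower_semicontinuous Phi ->
  subdiff Phi z y -> (forall z', subdiff Phi z' y -> z' = z) ->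
  grad (conjugate Phi) y = z.
Proof.
move=> pPhi cPhi lsc zy uz; have [a Pz] := subdiff_fin pPhi zy.
apply/rowP => i; rewrite mxE; apply/cvg_lim => //; apply/cvgrPdist_le => e e0.
have [k k0 kc] := conjugate_expansion i pPhi cPhi lsc Pz zy uz e0.
(* At [h = 0] both bounds vanish, so the conjugate at [y] equals [dotp y z - a]. *)
have := kc 0; rewrite normr0 scale0r add0r !mul0r => /(_ (ltW k0))[c0 Pc0].
rewrite subr0 -eq_le => c0E.
near=> h.
have h0 : h != 0 by near: h; exact: nbhs_dnbhs_neq.
have [|c Pc /andP[cl cu]] := kc h.
  by apply: ltW; near: h; exact: dnbhs0_lt.
rewrite /= Pc Pc0/= -(@ler_pM2l _ `|h|) ?normr_gt0// -normrM.
rewrite mulrBr [X in _ - X](_ : _ = c - c0) ?ler_norml; last exact: mulVKf.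
by apply/andP; split; move/eqP: c0E => c0E; lra.
Unshelve. all: by end_near. Qed.

(** * Subgradients at points of differentiability, and the dual step *)

(** Dividing the subgradient inequality along an axis by [h < 0] and by [h > 0] bounds the partial
    derivative from above and from below. *)
Lemma subdiff_grad (R : realType) (d : nat) (Phi : 'rV[R]_d -> \bar R)
    (y z : 'rV[R]_d) :
  proper_fun Phi -> interior (edom Phi) z ->
  differentiable (fun w => fine (Phi w)) z -> subdiff Phi z y ->
  grad Phi z = y.
Proof.
move=> pPhi zE dPhi zy; have [a Pz] := subdiff_fin pPhi zy.
apply/rowP => i; rewrite mxE; set v := delta_mx 0 i.
have dv : derivable (fun w => fine (Phi w)) z v by exact: diff_derivable.
have cl : h *: v + z @[h --> (0 : R)] --> z.
  rewrite -[X in _ --> X]add0r -(scale0r v).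
  by apply: cvgD; [apply: cvgZ; [exact: cvg_id|exact: cvg_cst]|exact: cvg_cst].
(* Membership in [edom Phi] matters since [fine] sends [+oo] to 0; it holds for small [h] because
   [z] is interior. *)
have slope h : edom Phi (h *: v + z) ->
    h * y 0 i <= fine (Phi (h *: v + z)) - fine (Phi z).
  move=> /(proper_fin pPhi)[b Pb].
  have := (subdiffP _ pPhi Pz).1 zy _ _ Pb.
  by rewrite Pb Pz addrK dotpZr dotpC dotp_delta/=; lra.
apply/eqP; rewrite eq_le; apply/andP; split.
- rewrite /derive cvg_at_leftE//; apply: limr_le.
    exact: cvgP (cvg_dnbhs_at_left dv).
  near=> h.
  have h0 : h < 0 by near: h; exact: nbhs_left_lt.
  rewrite /= -(@ler_nM2l _ h)//.
  rewrite [leRHS](_ : _ = fine (Phi (h *: v + z)) - fine (Phi z)).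
    apply: slope; near: h; exact: (cvg_at_left_filter cl zE).
  by apply: mulVKf; rewrite lt_eqF.
- rewrite /derive cvg_at_rightE//; apply: limr_ge.
    exact: cvgP (cvg_dnbhs_at_right dv).
  near=> h.
  have h0 : 0 < h by near: h; exact: nbhs_right_gt.
  rewrite /= -(@ler_pM2l _ h)//.
  rewrite [leRHS](_ : _ = fine (Phi (h *: v + z)) - fine (Phi z)).
    apply: slope; near: h; exact: (cvg_at_right_filter cl zE).
  by apply: mulVKf; rewrite gt_eqF.
Unshelve. all: by end_near. Qed.

Lemma Legendre_dual_step (R : realType) (d : nat) (Phi : 'rV[R]_d -> \bar R)
    (y : 'rV[R]_d) :
  Legendre Phi -> interior (edom (conjugate Phi)) y ->
  interior (edom Phi) (grad (conjugate Phi) y) ->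
  subdiff Phi (grad (conjugate Phi) y) y /\
  grad Phi (grad (conjugate Phi) y) = y.
Proof.
move=> [pPhi cPhi lsc [_ dPhi _] scPhi] yE.
have [z zy] := subdiff_nonempty pPhi lsc yE.
have -> : grad (conjugate Phi) y = z.
  by apply: grad_conjugate => // z'; exact: subdiff_inj.
by move=> zE; split => //; apply: subdiff_grad => //; exact: dPhi.
Qed.

(** * Bregman estimates along the iteration *)

(** The values of [phi] cancel, so the identity is purely algebraic and [g] need not be the gradient
    of [phi]. *)
Lemma three_point (R : realType) (d : nat) (phi : 'rV[R]_d -> R)
    (g : 'rV[R]_d -> 'rV[R]_d) (u v w : 'rV[R]_d) :
  let D p q := phi p - phi q - dotp (g q) (p - q) in
  D w u + dotp (g u - g w) (w - v) = D v u - D v w.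
Proof. by rewrite /= dotpBl !dotpBr; ring. Qed.

Unset Implicit Arguments.

Theorem theorem2p2 (R : realType) (d : nat) (Phi : 'rV[R]_d -> \bar R)
  (f : 'rV[R]_d -> R) (Omega : 'rV[R]_d -> 'rV[R]_d)
  (t : nat) (K U : set 'rV[R]_d) (xs : 'rV[R]_d)
  (eta : nat -> R) (x : nat -> 'rV[R]_d)
  (hPhi : Legendre Phi)
  (hf : forall z : 'rV[R]_d, interior (edom Phi) z -> differentiable f z)
  (ht : (2 <= t)%N)
  (hK : K `<=` interior (edom Phi))
  (hxs : minimizer_over f K xs)
  (hU : U `<=` K)
  (hUxs : U xs)
  (hOmega : forall z : 'rV[R]_d, (K `\` U) z -> dotp (Omega z) (z - xs) >= f z - f xs)
  (heta : forall j, (1 <= j < t)%N -> 0 < eta j)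
  (hx : forall j, (1 <= j <= t)%N -> K (x j))
  (hdual : forall j, (1 <= j < t)%N ->
    interior (edom (conjugate Phi)) (grad Phi (x j) - eta j *: Omega (x j)))
  (hstep : forall j, (1 <= j < t)%N ->
    x j.+1 = grad (conjugate Phi) (grad Phi (x j) - eta j *: Omega (x j)))
  (hdiv : forall j, (1 <= j < t)%N ->
    ((eta j * fdiv f Omega (x j.+1) (x j))%:E <=
       bregman Phi (x j.+1) (x j))%E) :
  ((f (x t) - f xs)%:E <=
     maxe (bregman Phi xs (x 1%N) * ((\sum_(1 <= j < t) eta j)%R^-1)%:E)
          (ereal_sup [set (f z - f xs)%:E | z in U]))%E.
Proof.
have pPhi : proper_fun Phi by case: hPhi.
(* On [K], inside the domain, [Phi] is finite, so the divergences can be handled as the real numbers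
   [D p q]. *)
pose phi z := fine (Phi z).
have finPhi z : K z -> Phi z = (phi z)%:E.
  move=> /hK /interior_subset /(proper_fin pPhi)[a Pz].
  by rewrite /phi Pz.
pose D p q := phi p - phi q - dotp (grad Phi q) (p - q).
have bregE p q : K p -> K q -> bregman Phi p q = (D p q)%:E.
  by move=> Kp Kq; rewrite /bregman !finPhi.
have Kxs : K xs := hxs.1.
have jt j : (1 <= j < t)%N -> K (x j) /\ K (x j.+1).
  by move=> /andP[j1 jt]; split; apply: hx; rewrite ?j1 ?(ltnW jt)//.
(* Nonnegativity is the subgradient inequality at [x j.+1]; it is obtained only at points produced
   by a step. *)
have dual j : (1 <= j < t)%N ->
    grad Phi (x j.+1) = grad Phi (x j) - eta j *: Omega (x j) /\
    forall p, K p -> 0 <= D p (x j.+1).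
  move=> j1t; have [_ Kxj1] := jt _ j1t.
  have [|sub gE] := Legendre_dual_step hPhi (hdual _ j1t).
    by rewrite -hstep//; exact: hK.
  rewrite -!hstep// in sub gE; split => // p Kp; rewrite /D gE.
  by have := (subdiffP _ pPhi (finPhi _ Kxj1)).1 sub _ _ (finPhi _ Kp); lra.
have etaOmega j v : (1 <= j < t)%N ->
    eta j * dotp (Omega (x j)) v = dotp (grad Phi (x j) - grad Phi (x j.+1)) v.
  by move=> /dual[-> _]; rewrite opprB addrCA subrr addr0 dotpZl.
have decr_three j p : (1 <= j < t)%N ->
    eta j * (f (x j.+1) - f (x j)) + eta j * dotp (Omega (x j)) (x j - p)
    <= D p (x j) - D p (x j.+1).
  move=> j1t; have [Kxj Kxj1] := jt _ j1t.
  have := hdiv _ j1t; rewrite bregE// lee_fin /fdiv => hd.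
  have := three_point phi (grad Phi) (x j) p (x j.+1).
  rewrite -etaOmega//= => h3.
  have : dotp (Omega (x j)) (x j.+1 - p) =
         dotp (Omega (x j)) (x j - p) - dotp (Omega (x j)) (x j - x j.+1).
    by rewrite !dotpBr; ring.
  by move: hd h3; rewrite /D => hd h3 E; rewrite E in h3; lra.
have fmono j : (1 <= j < t)%N -> f (x j.+1) <= f (x j).
  move=> j1t; have [Kxj Kxj1] := jt _ j1t.
  have := decr_three j (x j) j1t; have [_ /(_ _ Kxj)] := dual _ j1t.
  have Dxx : D (x j) (x j) = 0 by rewrite /D dotpBr; ring.
  rewrite Dxx subrr [dotp _ 0](_ : _ = 0); last first.
    by rewrite -[0 in LHS](scale0r 0) dotpZr mul0r.
  rewrite mulr0 addr0 => D0 h.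
  by rewrite -subr_le0 -(pmulr_rle0 _ (heta _ j1t)); lra.
have fle j k : (1 <= j)%N -> (j + k <= t)%N -> f (x (j + k)%N) <= f (x j).
  move=> j1; elim: k => [|k IH]; first by rewrite addn0.
  rewrite addnS => jkt; apply: le_trans (IH (ltnW jkt)).
  by apply: fmono; rewrite jkt (leq_trans j1)// leq_addr.
have fxt j : (1 <= j <= t)%N -> f (x t) <= f (x j).
  by move=> /andP[j1 jt']; have := fle _ (t - j)%N j1; rewrite subnKC//; exact.
(* Splitting on the supremum bound itself: if it fails, monotonicity of [f (x j)] keeps every
   iterate out of [U]. *)
have [supU|/negP supU] := boolP
    ((f (x t) - f xs)%:E <= ereal_sup [set (f z - f xs)%:E | z in U])%E.
  by apply: le_trans supU _; rewrite le_max lexx orbT.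
have notU j : (1 <= j <= t)%N -> ~ U (x j).
  move=> j1t Uxj; apply: supU.
  apply: (@le_trans _ _ (f (x j) - f xs)%:E); last first.
    by apply: ereal_sup_ubound; exists (x j).
  by rewrite lee_fin lerD2r fxt.
have t1 : (1 <= t)%N by exact: ltnW.
have step j : (1 <= j < t)%N ->
    eta j * (f (x t) - f xs) <= D xs (x j) - D xs (x j.+1).
  move=> j1t; have [Kxj Kxj1] := jt _ j1t.
  have /andP[j1 jt1] := j1t.
  have Uxj : ~ U (x j) by apply: notU; rewrite j1 ltnW.
  (* With the growth hypothesis the terms [f (x j)] cancel, leaving [f (x j.+1) - f xs], which is at
     least [f (x t) - f xs]. *)
  apply: le_trans (decr_three _ xs j1t); rewrite -mulrDr ler_pM2l ?heta//.
  have := hOmega _ (conj Kxj Uxj); have := @fxt j.+1; rewrite jt1 => /(_ erefl).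
  by lra.
have sumD : \sum_(1 <= j < t) (D xs (x j) - D xs (x j.+1)) =
    D xs (x 1%N) - D xs (x t).
  rewrite -[RHS]opprB -(telescope_sumr (fun j => D xs (x j)) t1) -sumrN.
  by apply: eq_bigr => j _; rewrite opprB.
have eta_gt0 : 0 < \sum_(1 <= j < t) eta j.
  rewrite big_ltn// ltr_wpDr ?heta ?ht// big_nat sumr_ge0// => j /andP[j2 jt'].
  by rewrite ltW// heta// jt' ltnW.
(* Since [t >= 2], [x t] is produced by step [t.-1]. *)
have Dt0 : 0 <= D xs (x t).
  have [|_] := dual t.-1; last by rewrite prednK//; exact.
  by rewrite prednK// leqnn andbT -ltnS prednK.
apply: (@le_trans _ _ (bregman Phi xs (x 1%N) *
    ((\sum_(1 <= j < t) eta j)^-1)%:E)%E); last by rewrite le_max lexx.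
rewrite bregE//; last by apply: hx; rewrite t1.
rewrite -EFinM lee_fin ler_pdivlMr// mulrC.
apply: (@le_trans _ _ (D xs (x 1%N) - D xs (x t))); last by lra.
rewrite -sumD mulr_suml.
by rewrite big_nat [leRHS]big_nat; apply: ler_sum => j j1t; exact: step.
Qed.
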